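(* Let $J$ be an abelian (invariant) complex structure on a nilmanifold $M$ with underlying Lie algebra isomorphic to $\mathfrak h_5$. Then, for any invariant balanced $J$-Hermitian structure on $M$ there exists an invariant $\mathrm{SU}(3)$-instanton solving the Strominger system (with constant dilaton, and with the Bismut connection in the anomaly cancellation condition).
   Context: A nilmanifold is a compact quotient $M=\Gamma\backslash G$ of a simply-connected nilpotent Lie group by a lattice of maximal rank; its underlying Lie algebra is the Lie algebra $\mathfrak g$ of $G$. Invariant objects on $M$ are those induced by left-invariant objects on $G$; an invariant connection is one whose connection forms in a left-invariant coframe are left-invariant $1$-forms. $\mathfrak h_5$ is the Lie algebra whose dual has a basis with $de^1=de^2=de^3=de^4=0$, $de^5=e^1\wedge e^3+e^4\wedge e^2$, $de^6=e^1\wedge e^4+e^2\wedge e^3$. A complex structure $J$ on $\mathfrak g$ is abelian if $[JX,JY]=[X,Y]$ for all $X,Y$. $J$ acts on $1$-forms by $(J\alpha)(X)=-\alpha(JX)$. A Hermitian structure $(J,F)$ with metric $g$ has $F(X,Y)=g(X,JY)$, and is balanced (in dimension 6) if $d(F\wedge F)=0$. The Bismut connection is $\nabla=\nabla^g+\frac12T$, with $\nabla^g$ the Levi-Civita connection and $T=JdF$, i.e. $T(X,Y,Z)=-dF(JX,JY,JZ)$. For an invariant balanced Hermitian structure, fix an invariant orthonormal coframe $\{e^1,\ldots,e^6\}$ with $Je^1=-e^2$, $Je^3=-e^4$, $Je^5=-e^6$, $F=e^{12}+e^{34}+e^{56}$ ($e^{ij}=e^i\wedge e^j$), with dual frame $\{e_1,\ldots,e_6\}$,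 and the $\mathrm{SU}(3)$-structure $(J,F,\Psi)$ with $\Psi=(e^1+ie^2)\wedge(e^3+ie^4)\wedge(e^5+ie^6)$. For a connection with connection forms $\sigma^i_j$, the curvature forms are $\Omega^i_j=d\sigma^i_j+\sum_k\sigma^i_k\wedge\sigma^k_j$. An $\mathrm{SU}(3)$-instanton is an $\mathrm{SU}(3)$-connection $A$ (preserving $F$ and $\Psi$) whose curvature $2$-forms lie in $\mathfrak{su}(3)$, i.e. for all $i,j,k,l$: $(\Omega^A)^i_j(e_1,e_2)+(\Omega^A)^i_j(e_3,e_4)+(\Omega^A)^i_j(e_5,e_6)=0$ and $(\Omega^A)^i_j(Je_k,Je_l)=(\Omega^A)^i_j(e_k,e_l)$. A solution of the Strominger system with constant dilaton is a compact $6$-manifold with a Hermitian $\mathrm{SU}(3)$-structure $(J,F,\Psi)$ such that: (a) the holonomy of the Bismut connection $\nabla$ is contained in $\mathrm{SU}(3)$; (b) $(J,F)$ is balanced; (c) there is an $\mathrm{SU}(3)$-instanton $A$, required to be non-flat; (d) $dT=2\pi^2\alpha'\big(p_1(\nabla)-p_1(A)\big)$ for some constant $\alpha'>0$, where $p_1=\frac{1}{8\pi^2}\sum_{1\le i<j\le 6}\Omega^i_j\wedge\Omega^i_j$. (An instanton $A$ ''solves the Strominger system'' if (a)-(d) hold with it.) *)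

(* Defs.v *)
From HB Require Import structures.
From mathcomp Require Import all_boot all_order all_algebra.
From mathcomp Require Import all_classical all_reals all_analysis.
From mathcomp Require Import complex.
From mathcomp Require Import ring lra.

Set Implicit Arguments.
Unset Strict Implicit.
Unset Printing Implicit Defensive.

Import Order.TTheory GRing.Theory Num.Theory.
Import numFieldNormedType.Exports.

Local Open Scope classical_set_scope.
Local Open Scope ring_scope.
Local Open Scope complex_scope.

(* A 6-dimensional real Lie algebra is a bracket on the vector space 'rV[R]_6.
   Invariant tensors on a nilmanifold are multilinear maps on this space, and
   d is the Chevalley-Eilenberg differential (sign: d a (X, Y) = - a [X, Y]).
   Wedge products follow (a /\ b)(X, Y) = a X * b Y - a Y * b X. *)

Definition i1 : 'I_6 := @Ordinal 6 0 isT.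
Definition i2 : 'I_6 := @Ordinal 6 1 isT.
Definition i3 : 'I_6 := @Ordinal 6 2 isT.
Definition i4 : 'I_6 := @Ordinal 6 3 isT.
Definition i5 : 'I_6 := @Ordinal 6 4 isT.
Definition i6 : 'I_6 := @Ordinal 6 5 isT.

Section Forms.
Variables (V : Type) (S : comNzRingType).

Definition wedge11 (a b : V -> S) (X Y : V) : S := a X * b Y - a Y * b X.

Definition wedge111 (a b c : V -> S) (X Y Z : V) : S :=
  a X * wedge11 b c Y Z - a Y * wedge11 b c X Z + a Z * wedge11 b c X Y.

Definition wedge22 (a b : V -> V -> S) (X Y Z W : V) : S :=
  a X Y * b Z W - a X Z * b Y W + a X W * b Y Z
  + a Y Z * b X W - a Y W * b X Z + a Z W * b X Y.

Variable br : V -> V -> V.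

Definition d1 (a : V -> S) (X Y : V) : S := - a (br X Y).

Definition d2 (a : V -> V -> S) (X Y Z : V) : S :=
  - a (br X Y) Z + a (br X Z) Y - a (br Y Z) X.

Definition d3 (a : V -> V -> V -> S) (X Y Z W : V) : S :=
  - a (br X Y) Z W + a (br X Z) Y W - a (br X W) Y Z
  - a (br Y Z) X W + a (br Y W) X Z - a (br Z W) X Y.

Definition d4 (a : V -> V -> V -> V -> S) (X Y Z W U : V) : S :=
  - a (br X Y) Z W U + a (br X Z) Y W U - a (br X W) Y Z U + a (br X U) Y Z W
  - a (br Y Z) X W U + a (br Y W) X Z U - a (br Y U) X Z W
  - a (br Z W) X Y U + a (br Z U) X Y W - a (br W U) X Y Z.

End Forms.

Section Algebra.
Variable R : realType.
Local Notation V := 'rV[R]_6.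
Variables (br : V -> V -> V) (J : V -> V) (g : V -> V -> R).

Definition lie_bracket : Prop :=
  [/\ forall X, linear (br X),
      forall Y, linear (br^~ Y),
      forall X, br X X = 0
    & forall X Y Z, br X (br Y Z) + br Y (br Z X) + br Z (br X Y) = 0].

(* A basis of V is an invertible matrix e: its i-th vector is row i e, and
   coform e i is the i-th element of the dual basis. *)
Definition coform (e : 'M[R]_6) (i : 'I_6) (X : V) : R :=
  (X *m invmx e) ord0 i.

Definition is_h5 : Prop :=
  exists2 f : 'M[R]_6, f \in unitmx &
  (forall i : 'I_6, (i < 4)%N -> forall X Y, d1 br (coform f i) X Y = 0) /\
  (forall X Y, d1 br (coform f i5) X Y =
     wedge11 (coform f i1) (coform f i3) X Y
     + wedge11 (coform f i4) (coform f i2) X Y) /\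
  (forall X Y, d1 br (coform f i6) X Y =
     wedge11 (coform f i1) (coform f i4) X Y
     + wedge11 (coform f i2) (coform f i3) X Y).

Definition complex_structure : Prop :=
  [/\ linear J,
      forall X, J (J X) = - X
    & forall X Y, br (J X) (J Y) - br X Y - J (br (J X) Y) - J (br X (J Y)) = 0].

Definition abelian_structure : Prop :=
  forall X Y, br (J X) (J Y) = br X Y.

Definition inner_product : Prop :=
  [/\ forall X, scalar (g X),
      forall X Y, g X Y = g Y X
    & forall X, X != 0 -> 0 < g X X].

Definition hermitian_metric : Prop := forall X Y, g (J X) (J Y) = g X Y.

Definition fundF (X Y : V) : R := g X (J Y).

Definition balanced : Prop :=
  forall X Y Z W U, d4 br (wedge22 fundF fundF) X Y Z W U = 0.

(* T = J dF *)
Definition torsionT (X Y Z : V) : R := - d2 br fundF (J X) (J Y) (J Z).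

(* koszul X Y Z = g (D_X Y, Z) for D the Levi-Civita connection acting on
   left-invariant fields; see levi_civitaP. *)
Definition koszul (X Y Z : V) : R :=
  (g (br X Y) Z - g (br Y Z) X + g (br Z X) Y) / 2.

Definition levi_civita (D : V -> V -> V) : Prop :=
  (forall X Y, D X Y - D Y X = br X Y) /\
  (forall X Y Z, g (D X Y) Z + g Y (D X Z) = 0).

Lemma levi_civitaP (D : V -> V -> V) : lie_bracket -> inner_product ->
  levi_civita D <-> forall X Y Z, g (D X Y) Z = koszul X Y Z.
Proof.
move=> [brr brl bra _] [gl gs gp].
have gD X Y Z : g X (Y + Z) = g X Y + g X Z.
  by have := gl X 1 Y Z; rewrite !scale1r mul1r.
have g0 X : g X 0 = 0.
  by have := gD X 0 0; rewrite addr0 => h; lra.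
have gN X Y : g X (- Y) = - g X Y.
  by have := gD X Y (- Y); rewrite subrr g0 => h; lra.
have gDl X Y Z : g (X + Y) Z = g X Z + g Y Z.
  by rewrite gs gD !(gs Z).
have gNl X Y : g (- X) Y = - g X Y by rewrite gs gN gs.
have brN X Y : br X Y = - br Y X.
  apply/eqP; rewrite -addr_eq0; apply/eqP.
  have lD A B C : br (A + B) C = br A C + br B C.
    by have := brl C 1 A B; rewrite !scale1r.
  have rD A B C : br A (B + C) = br A B + br A C.
    by have := brr A 1 B C; rewrite !scale1r.
  by have := bra (X + Y); rewrite lD !rD !bra add0r addr0.
split.
  move=> [tf me] X Y Z.
  have E A B C : g (br A B) C = g (D A B) C - g (D B A) C.
    by rewrite -tf gDl gNl.
  rewrite /koszul !E.
  have h1 := me X Y Z; have h2 := me Y X Z; have h3 := me Z X Y.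
  rewrite !(gs X) !(gs Y) in h1 h2 h3 *; lra.
move=> k; have nd A B : (forall Z, g A Z = g B Z) -> A = B.
  move=> h; apply/eqP; rewrite -subr_eq0; apply/negPn/negP => /gp.
  by rewrite gDl gNl h subrr ltxx.
split.
  move=> X Y; apply: nd => Z; rewrite gDl gNl !k /koszul.
  rewrite (brN Y X) (brN X Z) (brN Z Y) !gNl; lra.
move=> X Y Z; rewrite (gs Y) !k /koszul.
rewrite (brN Z Y) (brN Z X) (brN Y X) !gNl; lra.
Qed.

Variable e : 'M[R]_6.

(* The coframe conditions use (J a)(X) = - a (J X). *)
Definition adapted_frame : Prop :=
  [/\ e \in unitmx,
      forall i j, g (row i e) (row j e) = (i == j)%:R,
      forall X, [/\ - coform e i1 (J X) = - coform e i2 X,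
                    - coform e i3 (J X) = - coform e i4 X
                  & - coform e i5 (J X) = - coform e i6 X]
    & forall X Y, fundF X Y =
        wedge11 (coform e i1) (coform e i2) X Y
        + wedge11 (coform e i3) (coform e i4) X Y
        + wedge11 (coform e i5) (coform e i6) X Y].

Definition Psi : V -> V -> V -> R[i] :=
  wedge111 (fun X => coform e i1 X +i* coform e i2 X)
           (fun X => coform e i3 X +i* coform e i4 X)
           (fun X => coform e i5 X +i* coform e i6 X).

(* The endomorphism with matrix M in the basis e: e_j |-> \sum_i M i j e_i. *)
Definition endo (M : 'M[R]_6) (Y : V) : V :=
  \sum_i \sum_j (M i j * coform e j Y) *: row i e.

Definition SU3 (P : 'M[R]_6) : Prop :=
  (forall X Y, fundF (endo P X) (endo P Y) = fundF X Y) /\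
  (forall X Y Z, Psi (endo P X) (endo P Y) (endo P Z) = Psi X Y Z).

(* An invariant connection is the matrix-valued 1-form
   s X i j = s^i_j X of its connection forms, D_X e_j = \sum_i s^i_j(X) e_i. *)
Definition cform (s : V -> 'M[R]_6) (i j : 'I_6) (X : V) : R := s X i j.

Definition preserves_F_Psi (s : V -> 'M[R]_6) : Prop :=
  (forall X Y Z, fundF (endo (s X) Y) Z + fundF Y (endo (s X) Z) = 0) /\
  (forall X Y Z W, Psi (endo (s X) Y) Z W + Psi Y (endo (s X) Z) W
                   + Psi Y Z (endo (s X) W) = 0).

Definition curvature (s : V -> 'M[R]_6) (i j : 'I_6) (X Y : V) : R :=
  d1 br (cform s i j) X Y + \sum_k wedge11 (cform s i k) (cform s k j) X Y.

Definition bismut (X : V) : 'M[R]_6 :=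
  \matrix_(i, j) (koszul X (row j e) (row i e)
                  + torsionT X (row j e) (row i e) / 2).

Definition su3_instanton (s : V -> 'M[R]_6) : Prop :=
  [/\ preserves_F_Psi s,
      forall i j, curvature s i j (row i1 e) (row i2 e)
                  + curvature s i j (row i3 e) (row i4 e)
                  + curvature s i j (row i5 e) (row i6 e) = 0
    & forall i j k l, curvature s i j (J (row k e)) (J (row l e))
                      = curvature s i j (row k e) (row l e)].

Definition non_flat (s : V -> 'M[R]_6) : Prop :=
  exists i j X Y, curvature s i j X Y != 0.

Definition p1 (s : V -> 'M[R]_6) (X Y Z W : V) : R :=
  (8 * pi ^+ 2)^-1 *
  \sum_(i < 6) \sum_(j < 6 | (i < j)%N)
    wedge22 (curvature s i j) (curvature s i j) X Y Z W.

(* The simply-connected Lie group of a 2-step nilpotent Lie algebra such as h5,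
   in exponential coordinates (Baker-Campbell-Hausdorff); x^-1 is - x. *)
Definition gmul (x y : V) : V := x + y + 2^-1 *: br x y.

Definition lattice (Gamma : set V) : Prop :=
  [/\ Gamma 0,
      forall x y, Gamma x -> Gamma y -> Gamma (gmul x y),
      forall x, Gamma x -> Gamma (- x),
      \forall x \near (0 : V), Gamma x -> x = 0
    & exists2 K : set V, compact K &
        forall x, exists c k, [/\ Gamma c, K k & x = gmul c k]].

(* The tangent vector v at x, left-translated to the identity: the derivative
   at t = 0 of gmul (- x) (x + t *: v). *)
Definition maurer_cartan (x v : V) : V := v - 2^-1 *: br x v.

(* P is the parallel transport along a C^1 curve of the group from x to y, in
   the left-invariant frame e: U' = - s(c') U. *)
Definition C1_transport (s : V -> 'M[R]_6) (x y : V) (P : 'M[R]_6) : Prop :=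
  exists (c c' : R -> V) (U : R -> 'M[R]_6),
  [/\ forall t : R, is_derive t 1 c (c' t),
      continuous c',
      forall t : R, is_derive t 1 U (- s (maurer_cartan (c t) (c' t)) *m U t),
      c 0 = x /\ c 1 = y
    & U 0 = 1%:M /\ U 1 = P].

(* Piecewise C^1 curves, as concatenations. *)
Inductive transport (s : V -> 'M[R]_6) (x : V) : V -> 'M[R]_6 -> Prop :=
| Transport_refl : transport s x x 1%:M
| Transport_cat y z P Q :
    transport s x y P -> C1_transport s y z Q -> transport s x z (Q *m P).

(* A loop of Gamma \ G at the class of x lifts to a curve from x to a point of
   the orbit of x under left translations by Gamma. *)
Definition holonomy (Gamma : set V) (s : V -> 'M[R]_6) (x : V) : set 'M[R]_6 :=
  [set P | exists2 c, Gamma c & transport s x (gmul c x) P].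

Definition solves_strominger (Gamma : set V) (A : V -> 'M[R]_6) : Prop :=
  [/\ forall x P, holonomy Gamma bismut x P -> SU3 P,
      balanced,
      su3_instanton A /\ non_flat A
    & exists2 alpha' : R, 0 < alpha' &
        forall X Y Z W, d3 br torsionT X Y Z W =
          2 * pi ^+ 2 * alpha' * (p1 bismut X Y Z W - p1 A X Y Z W)].

End Algebra.

(* Main.v *)
Require Import Defs.
From HB Require Import structures.
From mathcomp Require Import all_boot all_order all_algebra.
From mathcomp Require Import all_classical all_reals all_analysis.
From mathcomp Require Import complex ring lra.

Import Order.TTheory GRing.Theory Num.Theory.
Import numFieldNormedType.Exports.

Local Open Scope classical_set_scope.
Local Open Scope ring_scope.
Local Open Scope complex_scope.

(** The centre of h5 is two dimensional and equal to the derived algebra; since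
    [J] is abelian it is [J]-invariant, hence spanned by a unit vector [Z] and
    [JZ] ([h5_center]).  So the whole bracket is encoded by the two 2-forms
    [b1 = g (Z, [., .])] and [b2 = g (JZ, [., .])].  They are [J]-invariant and
    vanish on the centre, and the balanced condition says exactly that they are
    primitive ([balanced_trace]): on the 4-dimensional orthogonal complement of
    the centre they are anti-self-dual.  The wedge product of two
    anti-self-dual forms is a negative constant times their scalar product
    times the volume form ([wedge_asd]).

    Because [J] is abelian the torsion simplifies so much that the Bismut
    connection has matrix [g ([e_i, e_j], X)] ([bismutE]).  At each [X] this is
    the matrix of a primitive (1,1)-form, that is an element of su(3); so the
    connection forms annihilate [F] and [Psi] ([preserves_bismut]), and parallel
    transport, being the solution of [U' = - s U], stays in SU(3)
    ([transport_SU3]).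

    The Bismut connection is not itself an instanton in general: its curvature
    has a term in [Z /\ JZ] given by the commutator of the matrices of [b1] and
    [b2].  The instanton is instead [A = (1/2) g (Z, .) B], with [B] the matrix
    of [b1].  All its values are multiples of one matrix, so its curvature is
    [- (1/2) B b1], a multiple of a primitive (1,1)-form, nonzero because [b1]
    is.

    Finally [dT = b1 /\ b1 + b2 /\ b2], and the commutator term does not
    contribute to [p1] of the Bismut connection, since a commutator is trace
    orthogonal to its factors.  With [N_ab] the scalar products of [b1] and [b2],
    the forms [dT], [p1] of the Bismut connection and [p1] of [A] are multiples
    of the same 4-form by [N_11 + N_22], [N_11 ^ 2 + 2 N_12 ^ 2 + N_22 ^ 2] and
    [N_11 ^ 2 / 4], up to negative constants, the same for the last two.  The
    factor 1/2 in [A] makes the difference of the last two positive, and this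
    yields a positive [alpha'] ([anomaly]). *)

(** * Six-element index sets and coordinates in a frame *)

Lemma sum_ord6 (W : nmodType) (f : 'I_6 -> W) :
  \sum_i f i = f i1 + f i2 + f i3 + f i4 + f i5 + f i6.
Proof.
rewrite !big_ord_recl big_ord0 addr0 !addrA.
by do !congr (_ + _); congr f; exact: val_inj.
Qed.

Lemma ord6_ind (P : 'I_6 -> Prop) :
  P i1 -> P i2 -> P i3 -> P i4 -> P i5 -> P i6 -> forall i, P i.
Proof.
by move=> p1 p2 p3 p4 p5 p6 [[|[|[|[|[|[|//]]]]]] h]; rewrite (bool_irrelevance h isT).
Qed.

Section Frame.
Set Implicit Arguments.
Unset Strict Implicit.
Variables (R : realType) (e : 'M[R]_6).
Local Notation V := 'rV[R]_6.
Hypothesis e_unit : e \in unitmx.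

Lemma coform_scalar (i : 'I_6) : scalar (coform e i).
Proof. by move=> a X Y; rewrite /coform mulmxDl -scalemxAl !mxE. Qed.

HB.instance Definition _ (i : 'I_6) :=
  GRing.isLinear.Build R V R *%R (coform e i) (coform_scalar i).

Lemma coform_sum (X : V) : X = \sum_i coform e i X *: row i e.
Proof. by rewrite -{1}(mulmxKV e_unit X) mulmx_sum_row. Qed.

Lemma coform_row (i j : 'I_6) : coform e i (row j e) = (i == j)%:R.
Proof. by rewrite /coform -row_mul mulmxV// row1 mxE eqxx eq_sym. Qed.

Lemma eq_coform (X Y : V) : (forall i, coform e i X = coform e i Y) -> X = Y.
Proof.
by move=> h; rewrite (coform_sum X) (coform_sum Y); apply: eq_bigr => i _; rewrite h.
Qed.

Lemma endoE (M : 'M[R]_6) (X : V) : endo e M X = X *m invmx e *m M^T *m e.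
Proof.
rewrite (mulmx_sum_row (X *m invmx e *m M^T) e) /endo; apply: eq_bigr => i _.
rewrite mxE -scaler_suml; congr (_ *: _).
by apply: eq_bigr => j _; rewrite [M^T _ _]mxE mulrC.
Qed.

Lemma coform_endo (M : 'M[R]_6) (X : V) (i : 'I_6) :
  coform e i (endo e M X) = \sum_j M i j * coform e j X.
Proof.
rewrite /coform endoE mulmxK// mxE.
by apply: eq_bigr => j _; rewrite [M^T _ _]mxE mulrC.
Qed.

Lemma endo1 (X : V) : endo e 1%:M X = X.
Proof. by rewrite endoE trmx1 mulmx1 mulmxKV. Qed.

Lemma endoM (M N : 'M[R]_6) (X : V) : endo e (M *m N) X = endo e M (endo e N X).
Proof. by rewrite !endoE trmx_mul mulmxK// !mulmxA. Qed.

Lemma endoN (M : 'M[R]_6) (X : V) : endo e (- M) X = - endo e M X.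
Proof. by rewrite !endoE linearN/= mulmxN mulNmx. Qed.

(** Linearity over the reals in each slot: it is the real and imaginary parts
    of [Psi], rather than [Psi], that are differentiated along a transport. *)
Definition real_trilinear (Phi : V -> V -> V -> R) : Prop :=
  [/\ forall Y Z, scalar (fun X => Phi X Y Z),
      forall X Z, scalar (fun Y => Phi X Y Z)
    & forall X Y, scalar (Phi X Y)].

Lemma scalar_sum (f : V -> R) : scalar f ->
  forall (c : 'I_6 -> R) (v : 'I_6 -> V), f (\sum_i c i *: v i) = \sum_i c i * f (v i).
Proof.
move=> fl c v; pose f' : {scalar V} := HB.pack f (GRing.isLinear.Build R V R *%R f fl).
rewrite -[f]/(f' : V -> R) linear_sum; apply: eq_bigr => i _.
by rewrite linearZ.
Qed.

Lemma trilinear_sum (Phi : V -> V -> V -> R) (X Y Z : V) :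
  real_trilinear Phi ->
  Phi X Y Z = \sum_i \sum_j \sum_k
    coform e i X * (coform e j Y * (coform e k Z * Phi (row i e) (row j e) (row k e))).
Proof.
move=> [l1 l2 l3].
rewrite {1}(coform_sum X) (scalar_sum (l1 _ _)); apply: eq_bigr => i _.
rewrite {1}(coform_sum Y) (scalar_sum (l2 _ _)) mulr_sumr; apply: eq_bigr => j _.
rewrite {1}(coform_sum Z) (scalar_sum (l3 _ _)) !mulr_sumr.
by apply: eq_bigr.
Qed.

Lemma is_derive_coform_endo (U : R -> 'M[R]_6) (dU : 'M[R]_6) (t : R) (X : V)
    (i : 'I_6) :
  is_derive t 1 U dU ->
  is_derive t 1 (fun s => coform e i (endo e (U s) X)) (coform e i (endo e dU X)).
Proof.
move=> [dU1 dU2].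
have dUij j k : is_derive t 1 (fun s => U s j k) (dU j k).
  have /derivable_mxP h := dU1; split; first exact: h.
  by rewrite -dU2 derive_mx// mxE.
rewrite coform_endo.
have -> : (fun s => coform e i (endo e (U s) X)) =
    \sum_j (fun s => U s i j) * cst (coform e j X).
  by apply/funext => s; rewrite coform_endo fct_sumE.
apply: is_derive_sum => j.
apply: is_derive_eq (is_deriveM (dUij i j) (is_derive_cst (coform e j X) t 1)) _.
by rewrite /= scaler0 add0r /GRing.scale/= mulrC.
Qed.

(** The Leibniz rule, reduced by [trilinear_sum] to products of real functions. *)
Lemma is_derive_trilinear (Phi : V -> V -> V -> R) (x y z : R -> V) (x' y' z' : V) (t : R) :
  real_trilinear Phi ->
  (forall i, is_derive t 1 (coform e i \o x) (coform e i x')) ->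
  (forall i, is_derive t 1 (coform e i \o y) (coform e i y')) ->
  (forall i, is_derive t 1 (coform e i \o z) (coform e i z')) ->
  is_derive t 1 (fun s => Phi (x s) (y s) (z s))
    (Phi x' (y t) (z t) + Phi (x t) y' (z t) + Phi (x t) (y t) z').
Proof.
move=> Pl dx dy dz; rewrite !(trilinear_sum _ _ _ Pl).
have -> : (fun s => Phi (x s) (y s) (z s)) = \sum_i \sum_j \sum_k
   (coform e i \o x) * ((coform e j \o y) * ((coform e k \o z)
     * cst (Phi (row i e) (row j e) (row k e)))).
  apply/funext => s; rewrite (trilinear_sum _ _ _ Pl) fct_sumE.
  apply: eq_bigr => i _; rewrite fct_sumE; apply: eq_bigr => j _.
  by rewrite fct_sumE; apply: eq_bigr => k _.
rewrite -!big_split/=; apply: is_derive_sum => i.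
rewrite -!big_split/=; apply: is_derive_sum => j.
rewrite -!big_split/=; apply: is_derive_sum => k.
have dc := is_derive_cst (Phi (row i e) (row j e) (row k e)) t 1.
apply: is_derive_eq (is_deriveM (dx i) (is_deriveM (dy j) (is_deriveM (dz k) dc))) _.
rewrite !fctE /GRing.scale/=; ring.
Qed.

End Frame.

(** * Parallel transport and invariant tensors *)

Section Holonomy.
Set Implicit Arguments.
Unset Strict Implicit.
Variables (R : realType) (br : 'rV[R]_6 -> 'rV[R]_6 -> 'rV[R]_6).
Variables (J : 'rV[R]_6 -> 'rV[R]_6) (g : 'rV[R]_6 -> 'rV[R]_6 -> R).
Variable e : 'M[R]_6.
Local Notation V := 'rV[R]_6.
Hypothesis adapted : adapted_frame J g e.

Let e_unit : e \in unitmx. Proof. by case: adapted. Qed.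

Let fundFE X Y : fundF J g X Y =
  wedge11 (coform e i1) (coform e i2) X Y
  + wedge11 (coform e i3) (coform e i4) X Y
  + wedge11 (coform e i5) (coform e i6) X Y.
Proof. by case: adapted. Qed.

(** The three curves are kept independent so that the same statement serves for
    a bilinear form, multiplied by a covector on a constant third curve. *)
Lemma trilinear_constant (Phi : V -> V -> V -> R) (x y z : R -> V) (x' y' z' : R -> V) :
  real_trilinear Phi ->
  (forall (t : R) i, is_derive t 1 (coform e i \o x) (coform e i (x' t))) ->
  (forall (t : R) i, is_derive t 1 (coform e i \o y) (coform e i (y' t))) ->
  (forall (t : R) i, is_derive t 1 (coform e i \o z) (coform e i (z' t))) ->
  (forall t, Phi (x' t) (y t) (z t) + Phi (x t) (y' t) (z t)
             + Phi (x t) (y t) (z' t) = 0) ->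
  Phi (x 1) (y 1) (z 1) = Phi (x 0) (y 0) (z 0).
Proof.
move=> Pl dx dy dz inv.
apply: (@is_derive_0_is_cst _ (fun t => Phi (x t) (y t) (z t))) => t.
by rewrite -(inv t); apply: is_derive_trilinear.
Qed.

Lemma theta_linear (i j : 'I_6) (a : R) (X Y : V) :
  coform e i (a *: X + Y) +i* coform e j (a *: X + Y) =
  a%:C * (coform e i X +i* coform e j X) + (coform e i Y +i* coform e j Y).
Proof. by rewrite !linearP/=; simpc. Qed.

Lemma Psi_linear (a : R) :
  [/\ forall X X' Y Z, Psi e (a *: X + X') Y Z = a%:C * Psi e X Y Z + Psi e X' Y Z,
      forall X Y Y' Z, Psi e X (a *: Y + Y') Z = a%:C * Psi e X Y Z + Psi e X Y' Z
    & forall X Y Z Z', Psi e X Y (a *: Z + Z') = a%:C * Psi e X Y Z + Psi e X Y Z'].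
Proof.
by split=> *; rewrite /Psi /wedge111 /wedge11 !theta_linear; ring.
Qed.

Lemma Re_Psi_trilinear : real_trilinear (fun X Y Z => complex.Re (Psi e X Y Z)).
Proof.
have ReP (a : R) (z w : R[i]) :
    complex.Re (a%:C * z + w) = a * complex.Re z + complex.Re w.
  by case: z w => [? ?] [? ?] /=; rewrite mul0r subr0.
by split=> [Y Z|X Z|X Y] a u v; have [l1 l2 l3] := Psi_linear a;
  rewrite ?l1 ?l2 ?l3 ReP.
Qed.

Lemma Im_Psi_trilinear : real_trilinear (fun X Y Z => complex.Im (Psi e X Y Z)).
Proof.
have ImP (a : R) (z w : R[i]) :
    complex.Im (a%:C * z + w) = a * complex.Im z + complex.Im w.
  by case: z w => [? ?] [? ?] /=; rewrite mul0r addr0.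
by split=> [Y Z|X Z|X Y] a u v; have [l1 l2 l3] := Psi_linear a;
  rewrite ?l1 ?l2 ?l3 ImP.
Qed.

Lemma fundF_trilinear (Z0 : V -> R) : scalar Z0 ->
  real_trilinear (fun X Y Z => fundF J g X Y * Z0 Z).
Proof.
by move=> Zl; split=> [Y Z|X Z|X Y] a u v; rewrite ?Zl !fundFE /wedge11 ?linearP/=; ring.
Qed.

(** Moving a vector by [U t] gives a curve with derivative [- s (c') x], so an
    infinitesimal invariance of a tensor under the connection forms is the
    vanishing of the derivative of its values along such curves. *)
Lemma C1_transport_SU3 (s : V -> 'M[R]_6) x y P :
  preserves_F_Psi J g e s -> C1_transport br s x y P -> SU3 J g e P.
Proof.
move=> [sF sPsi] [c [c' [U [_ _ dU _ [U0 U1]]]]].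
pose S t := s (maurer_cartan br (c t) (c' t)).
pose x_ X t := endo e (U t) X.
pose x' X t := - endo e (S t) (x_ X t).
have dx X (t : R) i : is_derive t 1 (coform e i \o x_ X) (coform e i (x' X t)).
  rewrite /x' /x_ -endoN // -endoM//.
  by apply: is_derive_coform_endo => //; exact: dU.
have xE X : (x_ X 1 = endo e P X) * (x_ X 0 = X).
  by rewrite /x_ U0 U1 endo1.
split=> [X Y|X Y Z].
  (* the constant curve at [row i1 e], where [coform e i1] is 1, turns [F] into
     a trilinear form *)
  have h := @trilinear_constant (fun X Y Z => fundF J g X Y * coform e i1 Z)
    (x_ X) (x_ Y) (fun=> row i1 e) (x' X) (x' Y) (fun=> 0).
  move: h; rewrite /= !xE !coform_row// eqxx !mulr1; apply=> //.
  - exact/fundF_trilinear/coform_scalar.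
  - by move=> t i; rewrite linear0; exact: is_derive_cst.
  move=> t; rewrite /= linear0 !mulr1 mulr0 addr0 /x'.
  have := sF (maurer_cartan br (c t) (c' t)) (x_ X t) (x_ Y t).
  have FN A B : (fundF J g (- A) B = - fundF J g A B)
      * (fundF J g A (- B) = - fundF J g A B).
    by split; rewrite !fundFE /wedge11 !linearN/=; ring.
  by rewrite -/(S t) !FN -opprD => ->; rewrite oppr0.
have inv t : Psi e (x' X t) (x_ Y t) (x_ Z t) + Psi e (x_ X t) (x' Y t) (x_ Z t)
    + Psi e (x_ X t) (x_ Y t) (x' Z t) = 0.
  have := sPsi (maurer_cartan br (c t) (c' t)) (x_ X t) (x_ Y t) (x_ Z t).
  rewrite -/(S t) /x' => /(congr1 -%R); rewrite oppr0 => <-.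
  have thetaN i j W : coform e i (- W) +i* coform e j (- W) =
      - (coform e i W +i* coform e j W) by rewrite !linearN.
  by rewrite /Psi /wedge111 /wedge11 !thetaN; ring.
have complex_eq (z w : R[i]) : complex.Re z = complex.Re w -> complex.Im z = complex.Im w -> z = w.
  by case: z w => [? ?] [? ?] /= -> ->.
apply: complex_eq.
- have h := @trilinear_constant _ _ _ _ _ _ _ Re_Psi_trilinear (dx X) (dx Y) (dx Z).
  rewrite !xE in h; apply: h => t; have /(congr1 (@complex.Re R)) := inv t.
  by rewrite !raddfD.
- have h := @trilinear_constant _ _ _ _ _ _ _ Im_Psi_trilinear (dx X) (dx Y) (dx Z).
  rewrite !xE in h; apply: h => t; have /(congr1 (@complex.Im R)) := inv t.
  by rewrite !raddfD.
Qed.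

Lemma SU3_1 : SU3 J g e 1%:M.
Proof. by split=> *; rewrite !endo1. Qed.

Lemma SU3_mul P Q : SU3 J g e P -> SU3 J g e Q -> SU3 J g e (Q *m P).
Proof.
by move=> [Pf Ps] [Qf Qs]; split=> *; rewrite !endoM// ?Qf ?Pf// Qs Ps.
Qed.

Lemma transport_SU3 (s : V -> 'M[R]_6) x y P :
  preserves_F_Psi J g e s -> transport br s x y P -> SU3 J g e P.
Proof.
move=> s_su3; elim=> [|{}y z {}P Q _ P_SU3 /(C1_transport_SU3 s_su3) Q_SU3].
  exact: SU3_1.
exact: SU3_mul.
Qed.

End Holonomy.

(** * Primitive (1,1)-forms as matrices of su(3) *)

Section Adapted.
Set Implicit Arguments.
Unset Strict Implicit.
Variables (R : realType) (J : 'rV[R]_6 -> 'rV[R]_6).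
Variables (g : 'rV[R]_6 -> 'rV[R]_6 -> R) (e : 'M[R]_6).
Local Notation V := 'rV[R]_6.
Hypotheses (JJ : forall X, J (J X) = - X) (adapted : adapted_frame J g e).

Let e_unit : e \in unitmx. Proof. by case: adapted. Qed.

Let fundFE X Y : fundF J g X Y =
  wedge11 (coform e i1) (coform e i2) X Y
  + wedge11 (coform e i3) (coform e i4) X Y
  + wedge11 (coform e i5) (coform e i6) X Y.
Proof. by case: adapted. Qed.

Lemma coformJ (X : V) :
  [/\ coform e i1 (J X) = coform e i2 X, coform e i2 (J X) = - coform e i1 X,
      coform e i3 (J X) = coform e i4 X, coform e i4 (J X) = - coform e i3 X
    & coform e i5 (J X) = coform e i6 X /\ coform e i6 (J X) = - coform e i5 X].
Proof.
have [_ _ h _] := adapted.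
have [/oppr_inj h1 /oppr_inj h3 /oppr_inj h5] := h X.
have [/oppr_inj k1 /oppr_inj k3 /oppr_inj k5] := h (J X).
by rewrite h1 h3 h5 -k1 -k3 -k5 JJ !linearN.
Qed.

Lemma J_row :
  [/\ J (row i1 e) = - row i2 e, J (row i2 e) = row i1 e,
      J (row i3 e) = - row i4 e, J (row i4 e) = row i3 e
    & J (row i5 e) = - row i6 e /\ J (row i6 e) = row i5 e].
Proof.
by do ?split; apply: (eq_coform e_unit);
  match goal with |- context [J ?X] => have [h1 h2 h3 h4 [h5 h6]] := coformJ X end;
  apply: ord6_ind; rewrite ?h1 ?h2 ?h3 ?h4 ?h5 ?h6 ?linearN/= !coform_row ?oppr0.
Qed.

Variable beta : V -> V -> R.
Hypotheses (beta_scalar : forall X, scalar (beta X))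
  (beta_anti : forall X Y, beta X Y = - beta Y X)
  (betaJ : forall X Y, beta (J X) (J Y) = beta X Y).

Lemma two_form_opp X Y : (beta (- X) Y = - beta X Y) * (beta X (- Y) = - beta X Y).
Proof.
have r A B : beta A (- B) = - beta A B.
  have s0 : beta A 0 = 0.
    by have := beta_scalar A 1 0 0; rewrite scaler0 add0r mul1r => h; lra.
  have := beta_scalar A (-1) B 0.
  by rewrite addr0 scaleN1r s0 addr0 mulN1r.
by rewrite r (beta_anti (- X)) r (beta_anti X).
Qed.

(** A [J]-invariant 2-form is skew-Hermitian as a matrix: its 2 by 2 blocks off
    the diagonal represent complex numbers. *)
Lemma beta_entries :
  let b i j := beta (row i e) (row j e) in
  [/\ b i2 i4 = b i1 i3, b i2 i3 = - b i1 i4,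
      b i2 i6 = b i1 i5, b i2 i5 = - b i1 i6
    & b i4 i6 = b i3 i5 /\ b i4 i5 = - b i3 i6].
Proof.
have [h1 h2 h3 h4 [h5 h6]] := J_row.
split; last split; rewrite -[in RHS]betaJ ?h1 ?h2 ?h3 ?h4 ?h5 ?h6 !two_form_opp ?opprK //.
Qed.

Let M : 'M[R]_6 := \matrix_(i, j) beta (row i e) (row j e).

Hypothesis primitive : beta (row i1 e) (row i2 e) + beta (row i3 e) (row i4 e)
  + beta (row i5 e) (row i6 e) = 0.

(** The matrix of a primitive (1,1)-form, with its eight independent entries
    displayed; [primitive] eliminates the entry in position (5, 6). *)
Lemma coform_endo_su3 X :
  let b i j := beta (row i e) (row j e) in
  let x i := coform e i X in
  let y i := coform e i (endo e M X) in
  [/\ y i1 = b i1 i2 * x i2 + b i1 i3 * x i3 + b i1 i4 * x i4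
             + b i1 i5 * x i5 + b i1 i6 * x i6,
      y i2 = - b i1 i2 * x i1 - b i1 i4 * x i3 + b i1 i3 * x i4
             - b i1 i6 * x i5 + b i1 i5 * x i6,
      y i3 = - b i1 i3 * x i1 + b i1 i4 * x i2 + b i3 i4 * x i4
             + b i3 i5 * x i5 + b i3 i6 * x i6,
      y i4 = - b i1 i4 * x i1 - b i1 i3 * x i2 - b i3 i4 * x i3
             - b i3 i6 * x i5 + b i3 i5 * x i6
    & y i5 = - b i1 i5 * x i1 + b i1 i6 * x i2 - b i3 i5 * x i3
             + b i3 i6 * x i4 - (b i1 i2 + b i3 i4) * x i6
      /\ y i6 = - b i1 i6 * x i1 - b i1 i5 * x i2 - b i3 i6 * x i3
             - b i3 i5 * x i4 + (b i1 i2 + b i3 i4) * x i5].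
Proof.
move=> b x y.
have yE i : y i = \sum_j b i j * x j.
  by rewrite /y coform_endo//; apply: eq_bigr => j _; rewrite mxE.
have bC i j : b i j = - b j i by exact: beta_anti.
have b0 i : b i i = 0 by have := bC i i => h; lra.
have [b24 b23 b26 b25 [b46 b45]] := beta_entries.
have b56 : b i5 i6 = - (b i1 i2 + b i3 i4) by rewrite -[RHS]addr0 -primitive addKr.
rewrite !yE !sum_ord6 !b0 (bC i2 i1) (bC i3 i1) (bC i3 i2) (bC i4 i1) (bC i4 i2).
rewrite (bC i4 i3) (bC i5 i1) (bC i5 i2) (bC i5 i3) (bC i5 i4) (bC i6 i1).
rewrite (bC i6 i2) (bC i6 i3) (bC i6 i4) (bC i6 i5).
rewrite [b i2 i4]b24 [b i2 i3]b23 [b i2 i6]b26 [b i2 i5]b25 [b i4 i6]b46 [b i4 i5]b45 b56.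
by rewrite -!/(b _ _); do ?split; ring.
Qed.

Lemma su3_fundF X Y : fundF J g (endo e M X) Y + fundF J g X (endo e M Y) = 0.
Proof.
rewrite !fundFE /wedge11.
have [-> -> -> -> [-> ->]] := coform_endo_su3 X.
have [-> -> -> -> [-> ->]] := coform_endo_su3 Y.
ring.
Qed.

(** On the complex covectors [th = e^1 + i e^2, ...] the endomorphism acts by a
    3 by 3 complex matrix, and on their wedge product by its trace, which is
    zero. *)
Lemma su3_Psi X Y Z : Psi e (endo e M X) Y Z + Psi e X (endo e M Y) Z
  + Psi e X Y (endo e M Z) = 0.
Proof.
pose b i j := beta (row i e) (row j e).
pose th i j W := coform e i W +i* coform e j W.
have h W : [/\ th i1 i2 (endo e M W) = (0 -i* b i1 i2) * th i1 i2 W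
       + (b i1 i3 -i* b i1 i4) * th i3 i4 W + (b i1 i5 -i* b i1 i6) * th i5 i6 W,
    th i3 i4 (endo e M W) = (- b i1 i3 -i* b i1 i4) * th i1 i2 W
       + (0 -i* b i3 i4) * th i3 i4 W + (b i3 i5 -i* b i3 i6) * th i5 i6 W
  & th i5 i6 (endo e M W) = (- b i1 i5 -i* b i1 i6) * th i1 i2 W
       + (- b i3 i5 -i* b i3 i6) * th i3 i4 W
       - ((0 -i* b i1 i2) + (0 -i* b i3 i4)) * th i5 i6 W].
  rewrite /th; have [-> -> -> -> [-> ->]] := coform_endo_su3 W.
  by split; simpc; congr (_ +i* _); rewrite /b; ring.
rewrite /Psi /wedge111 /wedge11 -!/(th _ _ _).
have [-> -> ->] := h X; have [-> -> ->] := h Y; have [-> -> ->] := h Z.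
ring.
Qed.

End Adapted.

(** * Orthonormal and adapted frames *)

Section Hermitian.
Set Implicit Arguments.
Unset Strict Implicit.
Variables (R : realType) (J : 'rV[R]_6 -> 'rV[R]_6).
Variable g : 'rV[R]_6 -> 'rV[R]_6 -> R.
Local Notation V := 'rV[R]_6.
Hypotheses (J_linear : linear J) (JJ : forall X, J (J X) = - X).
Hypotheses (g_inner : inner_product g) (gJJ : hermitian_metric J g).

Let g_scalar X : scalar (g X). Proof. by case: g_inner. Qed.
Let gC X Y : g X Y = g Y X. Proof. by case: g_inner. Qed.
Let g_gt0 X : X != 0 -> 0 < g X X. Proof. by case: g_inner => _ _; apply. Qed.

HB.instance Definition _ := GRing.isLinear.Build R V V *:%R J J_linear.
HB.instance Definition _ X := GRing.isLinear.Build R V R *%R (g X) (g_scalar X).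

Lemma skewJ X Y : g X (J Y) = - g (J X) Y.
Proof. by rewrite -gJJ JJ linearN. Qed.

Lemma orthJ X : g X (J X) = 0.
Proof. by have := skewJ X X; rewrite (gC (J X)) => h; lra. Qed.

(** Coordinates of [u] in the canonical basis, whose vectors are the rows of the
    identity matrix. *)
Lemma inner_coord (u Y : V) : g u Y = \sum_i u 0 i * g (row i 1%:M) Y.
Proof.
rewrite {1}[u]row_sum_delta gC linear_sum.
by apply: eq_bigr => i _; rewrite linearZ/= gC row1.
Qed.

Lemma matrix_inner (A E : 'M[R]_6) :
  A *m (\matrix_(i, j) g (row i 1%:M) (row j E)) =
  \matrix_(i, j) g (row i A) (row j E).
Proof.
apply/matrixP => i j; rewrite mxE [RHS]mxE inner_coord.
by apply: eq_bigr => k _; rewrite !mxE.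
Qed.

Lemma orthonormal_unit (E : 'M[R]_6) :
  (forall i j, g (row i E) (row j E) = (i == j)%:R) -> E \in unitmx.
Proof.
move=> orth; have := matrix_inner E E.
have -> : \matrix_(i, j) g (row i E) (row j E) = 1%:M.
  by apply/matrixP => i j; rewrite !mxE orth.
by move/mulmx1_unit => [].
Qed.

Lemma coform_orthonormal (E : 'M[R]_6) :
  (forall i j, g (row i E) (row j E) = (i == j)%:R) ->
  forall i X, coform E i X = g (row i E) X.
Proof.
move=> orth i X; have uE := orthonormal_unit orth.
rewrite [in RHS](coform_sum uE X) linear_sum (bigD1 i)//= big1 => [|j /negPf ji].
  by rewrite linearZ/= orth eqxx mulr1 addr0.
by rewrite linearZ/= orth eq_sym ji mulr0.
Qed.

Lemma parseval (E : 'M[R]_6) :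
  (forall i j, g (row i E) (row j E) = (i == j)%:R) ->
  forall X Y, g X Y = \sum_i coform E i X * coform E i Y.
Proof.
move=> orth X Y; have uE := orthonormal_unit orth.
rewrite [in LHS](coform_sum uE X) gC linear_sum; apply: eq_bigr => i _.
by rewrite linearZ/= gC !coform_orthonormal.
Qed.

(** Orthogonality to [k] vectors is a system of [k < 6] linear equations, so a
    nonzero solution exists. *)
Lemma orthogonal_unit_vector k (w : 'I_k -> V) : (k < 6)%N ->
  exists2 v, g v v = 1 & forall l, g v (w l) = 0.
Proof.
move=> k6; pose A : 'M[R]_(6, k) := \matrix_(i, l) g (row i 1%:M) (w l).
have kerA : kermx A != 0.
  by rewrite kermx_eq0 /row_free neq_ltn (leq_ltn_trans (rank_leq_col A) k6).
have [i u0] : exists i, row i (kermx A) != 0.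
  apply/existsP; apply: contraNT kerA; rewrite negb_exists => /forallP h.
  by apply/eqP/row_matrixP => i; rewrite row0; apply/eqP/negbNE/h.
set u := row i _ in u0.
have uA l : g u (w l) = 0.
  have := row_sub i (kermx A); rewrite sub_kermx -/u => /eqP/rowP/(_ l).
  rewrite mxE [RHS]mxE => <-; rewrite inner_coord.
  by apply: eq_bigr => j _; rewrite [A _ _]mxE.
have gu := g_gt0 u0; have s0 : Num.sqrt (g u u) != 0 by rewrite sqrtr_eq0 -ltNge.
have ss := sqr_sqrtr (ltW gu); set s := Num.sqrt _ in s0 ss.
exists (s^-1 *: u) => [|l]; first by rewrite linearZ/= gC linearZ/= -ss; field.
by rewrite gC linearZ/= gC uA mulr0.
Qed.

(** A Hermitian Gram-Schmidt process started at [Z]: every new vector is chosen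
    orthogonal to the previous ones and to their images under [J]. *)
Lemma exists_adapted_frame Z : g Z Z = 1 ->
  exists2 E, adapted_frame J g E & row i5 E = Z.
Proof.
move=> ZZ.
pose l2 : seq V := [:: Z; J Z].
have [w ww wl] := @orthogonal_unit_vector 2 (fun l => nth 0 l2 l) isT.
have wZ : g w Z = 0 := wl ord0.
have wJZ : g w (J Z) = 0 := wl (lift ord0 ord0).
pose l4 : seq V := [:: Z; J Z; w; J w].
have [v vv vl] := @orthogonal_unit_vector 4 (fun l => nth 0 l4 l) isT.
have vZ : g v Z = 0 := vl (Ordinal (isT : 0 < 4)%N).
have vJZ : g v (J Z) = 0 := vl (Ordinal (isT : 1 < 4)%N).
have vw : g v w = 0 := vl (Ordinal (isT : 2 < 4)%N).
have vJw : g v (J w) = 0 := vl (Ordinal (isT : 3 < 4)%N).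
(* the sign: [J e^1 = - e^2] on covectors means [e_2 = - J e_1] on vectors *)
pose l6 : seq V := [:: w; - J w; v; - J v; Z; - J Z].
pose E : 'M[R]_6 := \matrix_(i < 6) nth 0 l6 i.
have rE : [/\ row i1 E = w, row i2 E = - J w, row i3 E = v, row i4 E = - J v
            & row i5 E = Z /\ row i6 E = - J Z] by rewrite !rowK.
have [r1 r2 r3 r4 [r5 r6]] := rE.
have Jl X Y : g (J X) Y = - g X (J Y) by rewrite skewJ opprK.
have gNl X Y : g (- X) Y = - g X Y by rewrite gC linearN gC.
have perpC X Y : g X Y = 0 -> g X (J Y) = 0 -> g Y X = 0 /\ g Y (J X) = 0.
  by move=> XY XJY; rewrite gC XY skewJ gC XJY oppr0.
have [Zw ZJw] := perpC _ _ wZ wJZ; have [Zv ZJv] := perpC _ _ vZ vJZ.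
have [wv wJv] := perpC _ _ vw vJw.
have orth i j : g (row i E) (row j E) = (i == j)%:R.
  move: i j; apply: ord6_ind; apply: ord6_ind;
  by rewrite ?r1 ?r2 ?r3 ?r4 ?r5 ?r6 ?gNl ?(linearN (g _)) /= ?gJJ ?Jl ?opprK
    ?orthJ ?ww ?vv ?ZZ ?wZ ?wJZ ?vZ ?vJZ ?vw ?vJw ?Zw ?ZJw ?Zv ?ZJv ?wv ?wJv ?oppr0.
have uE := orthonormal_unit orth; have cE := coform_orthonormal orth.
have coJ X : [/\ coform E i1 (J X) = coform E i2 X, coform E i3 (J X) = coform E i4 X
    & coform E i5 (J X) = coform E i6 X].
  by rewrite !cE r1 r2 r3 r4 r5 r6 !gNl !skewJ.
exists E => //; split=> // [X|X Y]; first by have [-> -> ->] := coJ X.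
have coJ' : [/\ coform E i2 (J Y) = - coform E i1 Y, coform E i4 (J Y) = - coform E i3 Y
    & coform E i6 (J Y) = - coform E i5 Y].
  by have [<- <- <-] := coJ (J Y); rewrite JJ !linearN.
rewrite /fundF (parseval orth) sum_ord6 /wedge11.
have [-> -> ->] := coJ Y; have [-> -> ->] := coJ'; ring.
Qed.

(** The matrix of an orthonormal frame in another one is orthogonal, so its
    rows are contracted to a Kronecker delta by [parseval].  This is how what is
    computed in a frame adapted to the centre is carried to the given frame. *)
Lemma trace_orthonormal (e E : 'M[R]_6) (B : V -> V -> R) :
  (forall i j, g (row i e) (row j e) = (i == j)%:R) ->
  (forall i j, g (row i E) (row j E) = (i == j)%:R) ->
  (forall X, scalar (B X)) -> (forall Y, scalar (B^~ Y)) ->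
  \sum_i B (row i e) (row i e) = \sum_i B (row i E) (row i E).
Proof.
move=> oe oE Br Bl; have uE := orthonormal_unit oE.
have expand i : B (row i e) (row i e) = \sum_k \sum_l
    (coform e i (row k E) * coform e i (row l E)) * B (row k E) (row l E).
  rewrite {1}(coform_sum uE (row i e)) (scalar_sum (Bl _)); apply: eq_bigr => k _.
  rewrite {2}(coform_sum uE (row i e)) (scalar_sum (Br _)) mulr_sumr.
  apply: eq_bigr => l _; rewrite mulrA !coform_orthonormal// gC.
  by rewrite [g (row l E) _]gC.
rewrite (eq_bigr _ (fun i _ => expand i)) exchange_big; apply: eq_bigr => k _ /=.
rewrite exchange_big (bigD1 k)//= [X in _ + X]big1 ?addr0 => [|l lk].
  by rewrite -mulr_suml -parseval// oE eqxx mul1r.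
by rewrite -mulr_suml -parseval// oE eq_sym (negPf lk) mul0r.
Qed.

Variable e : 'M[R]_6.
Hypothesis adapted : adapted_frame J g e.

(** The contraction of a 2-form with [F], written as a trace so that
    [trace_orthonormal] applies. *)
Lemma J_trace (B : V -> V -> R) : (forall X, scalar (B X)) ->
  (forall X Y, B X Y = - B Y X) ->
  \sum_i B (row i e) (J (row i e)) =
  - 2 * (B (row i1 e) (row i2 e) + B (row i3 e) (row i4 e) + B (row i5 e) (row i6 e)).
Proof.
move=> Bs BA; have [h1 h2 h3 h4 [h5 h6]] := J_row JJ adapted.
rewrite sum_ord6 h1 h2 h3 h4 h5 h6 !(two_form_opp Bs BA).
rewrite (BA (row i2 e)) (BA (row i4 e)) (BA (row i6 e)); ring.
Qed.

End Hermitian.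

(** * Anti-self-dual forms on the complement of the centre *)

Section AntiSelfDual.
Set Implicit Arguments.
Unset Strict Implicit.
Variables (R : realType) (J : 'rV[R]_6 -> 'rV[R]_6).
Variable g : 'rV[R]_6 -> 'rV[R]_6 -> R.
Local Notation V := 'rV[R]_6.
Hypotheses (J_linear : linear J) (JJ : forall X, J (J X) = - X).
Hypotheses (g_inner : inner_product g) (gJJ : hermitian_metric J g).

(** Here [row i5 E], and so also [row i6 E], is to be central; on the span of
    the other four vectors, anti-self-dual forms are the primitive
    (1,1)-forms. *)
Definition asd (E : 'M[R]_6) (beta : V -> V -> R) : Prop :=
  [/\ forall X, scalar (beta X), forall X Y, beta X Y = - beta Y X,
      forall X Y, beta (J X) (J Y) = beta X Y,
      forall X, beta (row i5 E) X = 0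
    & beta (row i1 E) (row i2 E) + beta (row i3 E) (row i4 E) = 0].

Definition basic_vol (E : 'M[R]_6) : V -> V -> V -> V -> R :=
  wedge22 (wedge11 (coform E i1) (coform E i2)) (wedge11 (coform E i3) (coform E i4)).

Definition pairing (e : 'M[R]_6) (beta gamma : V -> V -> R) : R :=
  \sum_i \sum_j beta (row i e) (row j e) * gamma (row i e) (row j e).

Lemma anti_scalar_l (beta : V -> V -> R) : (forall X, scalar (beta X)) ->
  (forall X Y, beta X Y = - beta Y X) -> forall Y, scalar (beta^~ Y).
Proof. by move=> bl bC Y a X X'; rewrite !(bC _ Y) bl; ring. Qed.

(** The space of anti-self-dual forms in dimension four has dimension three. *)
Lemma asdE E beta : adapted_frame J g E -> asd E beta -> exists a b c : R,
  forall X Y, beta X Y =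
    a * (wedge11 (coform E i1) (coform E i2) X Y - wedge11 (coform E i3) (coform E i4) X Y)
  + b * (wedge11 (coform E i1) (coform E i3) X Y + wedge11 (coform E i2) (coform E i4) X Y)
  + c * (wedge11 (coform E i1) (coform E i4) X Y - wedge11 (coform E i2) (coform E i3) X Y).
Proof.
move=> aE [bl bC bJ b5 b34].
have uE : E \in unitmx by case: aE.
pose b i j := beta (row i E) (row j E).
exists (b i1 i2), (b i1 i3), (b i1 i4) => X Y.
have [b24 b23 _ _ _] := beta_entries JJ aE bl bC bJ.
have b0 Z : beta Z Z = 0 by have := bC Z Z => h; lra.
have b6 Z : beta (row i6 E) Z = 0.
  have [_ _ _ _ [_ J6]] := J_row JJ aE.
  by rewrite -bJ J6 b5.
have b5' Z : beta Z (row i5 E) = 0 by rewrite bC b5 oppr0.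
have b6' Z : beta Z (row i6 E) = 0 by rewrite bC b6 oppr0.
have b34' : beta (row i3 E) (row i4 E) = - b i1 i2.
  by rewrite -[RHS]addr0 -b34 addKr.
rewrite {1}(coform_sum uE X) (scalar_sum (anti_scalar_l bl bC _)) sum_ord6 b5 b6.
have bE i : beta (row i E) Y = \sum_j coform E j Y * b i j.
  by rewrite {1}(coform_sum uE Y) (scalar_sum (bl _)).
rewrite !bE !sum_ord6 /b !b5' !b6' !b0.
rewrite (bC (row i2 E) (row i1 E)) (bC (row i3 E) (row i1 E)) (bC (row i3 E) (row i2 E)).
rewrite (bC (row i4 E) (row i1 E)) (bC (row i4 E) (row i2 E)) (bC (row i4 E) (row i3 E)).
rewrite b24 b23 b34' -!/(b _ _) /wedge11; ring.
Qed.

Lemma pairing_orthonormal (e E : 'M[R]_6) (beta gamma : V -> V -> R) :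
  (forall i j, g (row i e) (row j e) = (i == j)%:R) ->
  (forall i j, g (row i E) (row j E) = (i == j)%:R) ->
  (forall X, scalar (beta X)) -> (forall X Y, beta X Y = - beta Y X) ->
  (forall X, scalar (gamma X)) -> (forall X Y, gamma X Y = - gamma Y X) ->
  pairing e beta gamma = pairing E beta gamma.
Proof.
move=> oe oE bl bC cl cC.
have bl' := anti_scalar_l bl bC; have cl' := anti_scalar_l cl cC.
have r1 X : scalar (fun Y => \sum_j beta X (row j e) * gamma Y (row j e)).
  move=> a Y Y'; rewrite mulr_sumr -big_split.
  by apply: eq_bigr => j _; rewrite /= cl'; ring.
have r2 Y : scalar (fun X => \sum_j beta X (row j e) * gamma Y (row j e)).
  move=> a X X'; rewrite mulr_sumr -big_split.
  by apply: eq_bigr => j _; rewrite /= bl'; ring.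
rewrite /pairing (trace_orthonormal g_inner oe oE r1 r2).
apply: eq_bigr => i _.
apply: (trace_orthonormal g_inner oe oE
  (B := fun X Y => beta (row i E) X * gamma (row i E) Y)) => U a X X'.
  by rewrite cl; ring.
by rewrite bl; ring.
Qed.

(** The negative sign of the wedge square is what determines the sign of
    [alpha'].  The pairing is taken in the given frame [e], where [p1] is
    defined, while the 4-form belongs to the frame [E] adapted to the centre. *)
Lemma wedge_asd (e E : 'M[R]_6) (beta gamma : V -> V -> R) :
  adapted_frame J g e -> adapted_frame J g E -> asd E beta -> asd E gamma ->
  forall X Y Z W,
  wedge22 beta gamma X Y Z W = - 2^-1 * pairing e beta gamma * basic_vol E X Y Z W.
Proof.
move=> ae aE asd_b asd_c X Y Z W.
have [a [b [c bE]]] := asdE aE asd_b; have [a' [b' [c' cE]]] := asdE aE asd_c.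
have [_ oe _ _] := ae; have [uE oE _ _] := aE.
have [bl bC _ _ _] := asd_b; have [cl cC _ _ _] := asd_c.
(* 4 = each of the three basic forms has four nonzero entries, all 1 or -1 *)
have -> : pairing e beta gamma = 4 * (a * a' + b * b' + c * c').
  rewrite (pairing_orthonormal oe oE)// /pairing !sum_ord6 !bE !cE /wedge11 !coform_row//=.
  ring.
rewrite /wedge22 /basic_vol !bE !cE /wedge22 /wedge11; by field.
Qed.

Lemma pairing_ge0 e beta : 0 <= pairing e beta beta.
Proof. by apply: sumr_ge0 => i _; apply: sumr_ge0 => j _; exact: sqr_ge0. Qed.

Lemma pairing_gt0 (e : 'M[R]_6) (beta : V -> V -> R) X Y :
  e \in unitmx -> (forall X, scalar (beta X)) -> (forall X Y, beta X Y = - beta Y X) ->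
  beta X Y != 0 -> 0 < pairing e beta beta.
Proof.
move=> ue bl bC bXY; rewrite lt_neqAle pairing_ge0 andbT eq_sym.
apply: contraNneq bXY => p0.
have row0 i : \sum_j beta (row i e) (row j e) * beta (row i e) (row j e) = 0.
  apply: (psumr_eq0P _ p0) => // k _.
  by apply: sumr_ge0 => j _; exact: sqr_ge0.
have b0 i j : beta (row i e) (row j e) = 0.
  have : beta (row i e) (row j e) * beta (row i e) (row j e) = 0.
    by apply: (psumr_eq0P _ (row0 i)) => // k _; exact: sqr_ge0.
  by move/eqP; rewrite mulf_eq0 orbb => /eqP.
rewrite (coform_sum ue X) (scalar_sum (anti_scalar_l bl bC _)) big1 // => i _.
rewrite {1}(coform_sum ue Y) (scalar_sum (bl _)) big1 ?mulr0// => j _.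
by rewrite b0 mulr0.
Qed.

End AntiSelfDual.

(** * The centre of h5 *)

Section Bracket.
Set Implicit Arguments.
Unset Strict Implicit.
Variables (R : realType) (br : 'rV[R]_6 -> 'rV[R]_6 -> 'rV[R]_6).
Variables (J : 'rV[R]_6 -> 'rV[R]_6) (g : 'rV[R]_6 -> 'rV[R]_6 -> R).
Local Notation V := 'rV[R]_6.
Hypotheses (br_lie : lie_bracket br) (J_linear : linear J) (JJ : forall X, J (J X) = - X).
Hypotheses (brJJ : abelian_structure br J).
Hypotheses (g_inner : inner_product g) (gJJ : hermitian_metric J g).

Let g_scalar X : scalar (g X). Proof. by case: g_inner. Qed.
Let gC X Y : g X Y = g Y X. Proof. by case: g_inner. Qed.
Let g_gt0 X : X != 0 -> 0 < g X X. Proof. by case: g_inner => _ _; apply. Qed.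
Let br_linear X : linear (br X). Proof. by case: br_lie. Qed.

HB.instance Definition _ := GRing.isLinear.Build R V V *:%R J J_linear.
HB.instance Definition _ X := GRing.isLinear.Build R V R *%R (g X) (g_scalar X).
HB.instance Definition _ X := GRing.isLinear.Build R V V *:%R (br X) (br_linear X).

Lemma bracketC X Y : br X Y = - br Y X.
Proof.
have [_ brl br0 _] := br_lie.
have brDl A B C : br (A + B) C = br A C + br B C.
  by have := brl C 1 A B; rewrite !scale1r.
by have := br0 (X + Y); rewrite linearD/= !brDl !br0 add0r addr0 => /eqP;
  rewrite addr_eq0 => /eqP ->; rewrite opprK.
Qed.

(** An abelian complex structure preserves the centre. *)
Lemma central_J X : (forall Y, br X Y = 0) -> forall Y, br (J X) Y = 0.
Proof. by move=> X0 Y; rewrite -brJJ JJ bracketC linearN/= opprK bracketC X0 oppr0. Qed.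

(** As [Z] and [JZ] are orthonormal, the last clause places every bracket in
    their span. *)
Definition center_spanned_by (Z : V) : Prop :=
  [/\ g Z Z = 1, forall Y, br Z Y = 0
    & forall X Y, br X Y = g Z (br X Y) *: Z + g (J Z) (br X Y) *: J Z].

(** The centre is spanned by the fifth and sixth vectors of the standard basis,
    and a vector of it is not an eigenvector of [J]; so [Z] can be the fifth one,
    normalised. *)
Lemma h5_center : is_h5 br ->
  exists2 Z, center_spanned_by Z & exists X Y, g Z (br X Y) != 0.
Proof.
move=> [f uf [d14 [d5 d6]]].
have co0 (i : 'I_6) X Y : (i < 4)%N -> coform f i (br X Y) = 0.
  by move=> i4; apply: oppr_inj; rewrite oppr0; exact: d14.
have brE X Y : br X Y = coform f i5 (br X Y) *: row i5 f + coform f i6 (br X Y) *: row i6 f.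
  rewrite {1}(coform_sum uf (br X Y)) sum_ord6.
  by rewrite (co0 i1)// (co0 i2)// (co0 i3)// (co0 i4)// !scale0r !add0r.
have c5 X Y : coform f i5 (br X Y) = - (wedge11 (coform f i1) (coform f i3) X Y
     + wedge11 (coform f i4) (coform f i2) X Y) by rewrite -d5 /d1 opprK.
have c6 X Y : coform f i6 (br X Y) = - (wedge11 (coform f i1) (coform f i4) X Y
     + wedge11 (coform f i2) (coform f i3) X Y) by rewrite -d6 /d1 opprK.
set F5 := row i5 f; set F6 := row i6 f.
have F5c Y : br F5 Y = 0.
  rewrite brE c5 c6 /wedge11 /F5 !coform_row//=.
  by rewrite !(mul0r, mulr0, subrr, addr0, oppr0, scale0r).
have JF5c : forall Y, br (J F5) Y = 0 by exact: central_J.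
(* a central vector has no component along the first four basis vectors *)
have JF5E : J F5 = coform f i5 (J F5) *: F5 + coform f i6 (J F5) *: F6.
  have z k : coform f i5 (br (J F5) (row k f)) = 0 by rewrite JF5c linear0.
  have := (z i1, z i2, z i3, z i4); rewrite !c5 /wedge11 !coform_row//= => -[[[z1 z2] z3] z4].
  rewrite {1}(coform_sum uf (J F5)) sum_ord6.
  have -> : coform f i1 (J F5) = 0 by lra.
  have -> : coform f i2 (J F5) = 0 by lra.
  have -> : coform f i3 (J F5) = 0 by lra.
  have -> : coform f i4 (J F5) = 0 by lra.
  by rewrite !scale0r !add0r.
set c := coform f i5 _ in JF5E; set d := coform f i6 _ in JF5E.
have F50 : F5 != 0.
  apply/eqP => F0; have := coform_row uf i5 i5.
  by rewrite -/F5 F0 linear0 eqxx => /eqP; rewrite eq_sym oner_eq0.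
(* otherwise [J F5 = c F5], and [c ^ 2 = - 1] *)
have d0 : d != 0.
  apply/eqP => d0; have := JJ F5; rewrite JF5E d0 scale0r addr0 linearZ/= JF5E d0 scale0r addr0.
  move=> /eqP; rewrite scalerA -addr_eq0 -[X in _ + X]scale1r -scalerDl scaler_eq0 (negPf F50) orbF.
  by rewrite gt_eqF// -expr2 ltr_wpDl// sqr_ge0.
have F6E : F6 = d^-1 *: (J F5 - c *: F5).
  by rewrite JF5E addrAC subrr add0r scalerA mulVf// scale1r.
have gF5 := g_gt0 F50.
set s := Num.sqrt (g F5 F5); have s0 : s != 0 by rewrite sqrtr_eq0 -ltNge.
have ss : s ^+ 2 = g F5 F5 by rewrite sqr_sqrtr// ltW.
have [Z ZE] : exists Z, Z = s^-1 *: F5 by exists (s^-1 *: F5).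
have ZZ : g Z Z = 1 by rewrite ZE linearZ/= gC linearZ/= -ss; field.
have F5E : F5 = s *: Z by rewrite ZE scalerA divff// scale1r.
have ZJZ := orthJ J_linear JJ g_inner gJJ Z.
exists Z.
  split=> // [Y|X Y]; first by rewrite ZE bracketC linearZ/= -scalerN -bracketC F5c scaler0.
  have [a [b ->]] : exists a b, br X Y = a *: Z + b *: J Z.
    set p := coform f i5 (br X Y); set q := coform f i6 (br X Y).
    exists ((p - q / d * c) * s), (q / d * s).
    rewrite brE -/p -/q -/F5 -/F6 F6E F5E (linearZ_LR J)/=.
    by apply/rowP => k; rewrite !mxE; ring.
  rewrite !linearD !linearZ/= gJJ ZZ ZJZ (gC (J Z)) ZJZ.
  by rewrite !mulr0 !mulr1 addr0 add0r.
exists (row i1 f), (row i3 f).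
rewrite brE c5 c6 /wedge11 !coform_row//= -/F5 F5E.
rewrite !(mul0r, mulr0, mulr1, subrr, subr0, addr0, oppr0, scale0r) scaleN1r.
by rewrite linearN linearZ/= ZZ mulr1 oppr_eq0.
Qed.

End Bracket.

(** * The Bismut connection and the instanton *)

Section Bismut.
Set Implicit Arguments.
Unset Strict Implicit.
Variables (R : realType) (br : 'rV[R]_6 -> 'rV[R]_6 -> 'rV[R]_6).
Variables (J : 'rV[R]_6 -> 'rV[R]_6) (g : 'rV[R]_6 -> 'rV[R]_6 -> R).
Local Notation V := 'rV[R]_6.
Hypotheses (br_lie : lie_bracket br) (J_linear : linear J) (JJ : forall X, J (J X) = - X).
Hypotheses (brJJ : abelian_structure br J).
Hypotheses (g_inner : inner_product g) (gJJ : hermitian_metric J g).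

Let g_scalar X : scalar (g X). Proof. by case: g_inner. Qed.
Let gC X Y : g X Y = g Y X. Proof. by case: g_inner. Qed.
Let br_linear X : linear (br X). Proof. by case: br_lie. Qed.
Let brC X Y : br X Y = - br Y X. Proof. exact: bracketC. Qed.

HB.instance Definition _ := GRing.isLinear.Build R V V *:%R J J_linear.
HB.instance Definition _ X := GRing.isLinear.Build R V R *%R (g X) (g_scalar X).
HB.instance Definition _ X := GRing.isLinear.Build R V V *:%R (br X) (br_linear X).

Let gNl X Y : g (- X) Y = - g X Y. Proof. by rewrite gC linearN gC. Qed.

(** Two of the three [J]'s in [JdF] are absorbed by the bracket, as [J] is
    abelian, and the last one cancels with that of [F]. *)
Lemma torsionE X Y Z :
  torsionT br J g X Y Z = - g (br X Y) Z + g (br X Z) Y - g (br Y Z) X.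
Proof.
rewrite /torsionT /d2 /fundF !brJJ !JJ !linearN /=; ring.
Qed.

(** Of the six terms of the Koszul formula and of half the torsion, four cancel
    in pairs and the other two are equal. *)
Lemma bismutE (e : 'M[R]_6) X i j :
  bismut br J g e X i j = g (br (row i e) (row j e)) X.
Proof.
rewrite mxE /koszul torsionE (brC (row i e) X) (brC (row i e)) !gNl; by field.
Qed.

Lemma d_torsion :
  (forall X Y Z, br (br X Y) Z = 0) ->
  forall X Y Z W, d3 br (torsionT br J g) X Y Z W =
    2 * (g (br X Y) (br Z W) - g (br X Z) (br Y W) + g (br X W) (br Y Z)).
Proof.
move=> br2 X Y Z W; rewrite /d3 !torsionE !br2.
have g0 U : g 0 U = 0 by rewrite gC linear0.
rewrite !g0 (gC (br Z W)) (gC (br Y W)) (gC (br Y Z)); ring.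
Qed.

Definition bracket_form (W X Y : V) : R := g W (br X Y).

Lemma bracket_form_props W :
  [/\ forall X, scalar (bracket_form W X),
      forall X Y, bracket_form W X Y = - bracket_form W Y X
    & forall X Y, bracket_form W (J X) (J Y) = bracket_form W X Y].
Proof.
split=> [X a Y Y'|X Y|X Y]; rewrite /bracket_form.
- by rewrite !linearP.
- by rewrite brC linearN.
- by rewrite brJJ.
Qed.

Variable Z : V.
Hypothesis Zc : center_spanned_by br J g Z.

Let ZZ : g Z Z = 1. Proof. by case: Zc. Qed.
Let brZ Y : br Z Y = 0. Proof. by case: Zc. Qed.
Let brJZ Y : br (J Z) Y = 0. Proof. exact: (central_J br_lie JJ brJJ brZ). Qed.
Let brE X Y : br X Y = g Z (br X Y) *: Z + g (J Z) (br X Y) *: J Z.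
Proof. by case: Zc. Qed.

Lemma two_step X Y W : br (br X Y) W = 0.
Proof.
rewrite brC (brE X Y) linearD !linearZ /= (brC W Z) brZ (brC W) brJZ.
by rewrite !oppr0 !scaler0 addr0 oppr0.
Qed.

Lemma g_bracket X Y W : g (br X Y) W =
  bracket_form Z X Y * g Z W + bracket_form (J Z) X Y * g (J Z) W.
Proof. by rewrite brE gC linearD !linearZ/= !(gC W). Qed.

Lemma d_torsion_wedge X Y U W : d3 br (torsionT br J g) X Y U W =
  wedge22 (bracket_form Z) (bracket_form Z) X Y U W
  + wedge22 (bracket_form (J Z)) (bracket_form (J Z)) X Y U W.
Proof.
rewrite (d_torsion two_step) !g_bracket -!/(bracket_form _ _ _) /wedge22; ring.
Qed.

(** In [d (F /\ F)] evaluated on the first four vectors of [E] and one of the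
    last two, a bracket is central, so [F] pairs it only with the last entry;
    of the other two entries [F] sees only those of index (1, 2) or (3, 4).
    What remains is one component of the sum of the two brackets. *)
Lemma balanced_trace (E : 'M[R]_6) : adapted_frame J g E -> row i5 E = Z ->
  balanced br J g -> br (row i1 E) (row i2 E) + br (row i3 E) (row i4 E) = 0.
Proof.
move=> aE E5 bal; have [uE oE _ FE] := aE.
have E6 : row i6 E = - J Z.
  by have [_ _ _ _ [J5 _]] := J_row JJ aE; rewrite -E5 J5 opprK.
have cE := coform_orthonormal g_inner oE.
have brC5 X : br X (row i5 E) = 0 by rewrite brC E5 brZ oppr0.
have brC6 X : br X (row i6 E) = 0 by rewrite E6 linearN/= brC brJZ !oppr0.
have orthZ (k : 'I_6) : (k < 4)%N -> forall X Y, coform E k (br X Y) = 0.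
  move=> k4 X Y; rewrite cE gC g_bracket -E5.
  have -> : J (row i5 E) = - row i6 E by rewrite E6 E5 opprK.
  rewrite gNl !oE; case: k k4 => -[|[|[|[|//]]]] //= ? _; by rewrite oppr0 !mulr0 addr0.
have o1 := orthZ i1 isT; have o2 := orthZ i2 isT; have o3 := orthZ i3 isT.
have o4 := orthZ i4 isT.
have F0 X : fundF J g 0 X = 0 by rewrite FE /wedge11 !linear0; ring.
have Fb X Y : (fundF J g (br X Y) (row i1 E) = 0) * (fundF J g (br X Y) (row i2 E) = 0)
    * (fundF J g (br X Y) (row i3 E) = 0) * (fundF J g (br X Y) (row i4 E) = 0)
    * (fundF J g (br X Y) (row i5 E) = - coform E i6 (br X Y))
    * (fundF J g (br X Y) (row i6 E) = coform E i5 (br X Y)).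
  by do !split; rewrite FE /wedge11 !(o1, o2, o3, o4) !coform_row//=; ring.
have Fe : (fundF J g (row i1 E) (row i2 E) = 1) * (fundF J g (row i3 E) (row i4 E) = 1)
    * (fundF J g (row i1 E) (row i3 E) = 0) * (fundF J g (row i1 E) (row i4 E) = 0)
    * (fundF J g (row i2 E) (row i3 E) = 0) * (fundF J g (row i2 E) (row i4 E) = 0).
  by do !split; rewrite FE /wedge11 !coform_row//=; ring.
have z5 := bal (row i1 E) (row i2 E) (row i3 E) (row i4 E) (row i5 E).
have z6 := bal (row i1 E) (row i2 E) (row i3 E) (row i4 E) (row i6 E).
apply: (eq_coform uE); apply: ord6_ind; rewrite linearD linear0 /= ?(o1, o2, o3, o4) ?addr0 //.
- by move: z6; rewrite /d4 !brC6 /wedge22 !(F0, Fb, Fe) => ?; lra.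
- by move: z5; rewrite /d4 !brC5 /wedge22 !(F0, Fb, Fe) => ?; lra.
Qed.

Lemma asd_bracket_form (E : 'M[R]_6) W : adapted_frame J g E -> row i5 E = Z ->
  balanced br J g -> asd J E (bracket_form W).
Proof.
move=> aE E5 bal; have [bl bC bJ] := bracket_form_props W.
split=> // [X|]; rewrite /bracket_form.
  by rewrite E5 brZ linear0.
by rewrite -linearD/= (balanced_trace aE E5 bal) linear0.
Qed.

Variable e : 'M[R]_6.
Hypotheses (adapted : adapted_frame J g e) (bal : balanced br J g).

Let e_orth i j : g (row i e) (row j e) = (i == j)%:R.
Proof. by case: adapted. Qed.

(** [F]-contraction does not depend on the adapted frame, and in one whose last
    two vectors are central it reduces to [balanced_trace]. *)
Lemma bracket_form_primitive W : let b := bracket_form W in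
  b (row i1 e) (row i2 e) + b (row i3 e) (row i4 e) + b (row i5 e) (row i6 e) = 0.
Proof.
have [E aE E5] := exists_adapted_frame J_linear JJ g_inner gJJ ZZ.
have [_ oE _ _] := aE.
have [bl bC bJ b5 b34] := asd_bracket_form W aE E5 bal.
have bl' := anti_scalar_l bl bC.
have tr := trace_orthonormal g_inner e_orth oE
  (B := fun X Y => bracket_form W X (J Y)).
have sr X : scalar (fun Y => bracket_form W X (J Y)).
  by move=> a Y Y'; rewrite linearP bl.
have := tr sr (fun Y => bl' (J Y)).
rewrite (J_trace JJ adapted bl bC) (J_trace JJ aE bl bC) b34 b5 addr0 mulr0 => h b.
rewrite /b; lra.
Qed.

(** The map [f] allows for connections that take values among those of the
    Bismut connection, such as the instanton. *)
Lemma preserves_bismut (f : V -> V) :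
  preserves_F_Psi J g e (fun X => bismut br J g e (f X)).
Proof.
have bE X : bismut br J g e X =
    \matrix_(i, j) bracket_form X (row i e) (row j e).
  by apply/matrixP => i j; rewrite bismutE// mxE gC.
split=> X *; have [bl bC bJ] := bracket_form_props (f X);
  have prim := bracket_form_primitive (f X); rewrite !bE.
- exact: (su3_fundF JJ adapted bl bC bJ prim).
- exact: (su3_Psi JJ adapted bl bC bJ prim).
Qed.

Let b1 := bracket_form Z.
Let b2 := bracket_form (J Z).
Let G1 i j := b1 (row i e) (row j e).
Let G2 i j := b2 (row i e) (row j e).
(** The commutator of the matrices of [b1] and [b2]. *)
Let K i j := \sum_k (G1 i k * G2 k j - G2 i k * G1 k j).

Let G1C i j : G1 i j = - G1 j i.
Proof. by have [_ bC _] := bracket_form_props Z; exact: bC. Qed.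
Let G2C i j : G2 i j = - G2 j i.
Proof. by have [_ bC _] := bracket_form_props (J Z); exact: bC. Qed.

Lemma commutatorC i j : K i j = - K j i.
Proof.
rewrite /K -sumrN; apply: eq_bigr => k _.
by rewrite (G1C i) (G2C i) (G1C k j) (G2C k j); ring.
Qed.

(** [tr (A [A, B]) = 0] by cyclicity of the trace. *)
Lemma commutator_orthogonal : (\sum_i \sum_j G1 i j * K i j = 0) *
  (\sum_i \sum_j G2 i j * K i j = 0).
Proof.
pose A := \matrix_(i, j) G1 i j; pose B := \matrix_(i, j) G2 i j.
have KE i j : K i j = (A *m B - B *m A) i j.
  rewrite !mxE -sumrB; apply: eq_bigr => k _.
  by rewrite !mxE.
have trE (M : 'M[R]_6) : \sum_i \sum_j M i j * K i j = \tr (M^T *m (A *m B - B *m A)).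
  rewrite /mxtrace exchange_big; apply: eq_bigr => j _; rewrite mxE.
  by apply: eq_bigr => i _; rewrite [M^T _ _]mxE KE.
have AT : A^T = - A by apply/matrixP => i j; rewrite !mxE G1C.
have BT : B^T = - B by apply/matrixP => i j; rewrite !mxE G2C.
have sumE (M : 'M[R]_6) (G : 'I_6 -> 'I_6 -> R) : (forall i j, G i j = M i j) ->
    \sum_i \sum_j G i j * K i j = \sum_i \sum_j M i j * K i j.
  by move=> GM; apply: eq_bigr => i _; apply: eq_bigr => j _; rewrite GM.
split; [rewrite (sumE A) => [|i j]; last by rewrite mxE
  |rewrite (sumE B) => [|i j]; last by rewrite mxE]; rewrite trE ?AT ?BT.
  rewrite mulNmx mulmxBr !linearN linearB /= (mulmxA A B A).
  by rewrite (mxtrace_mulC (A *m B)) subrr oppr0.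
rewrite mulNmx mulmxBr !linearN linearB /= (mulmxA B A B).
by rewrite (mxtrace_mulC (B *m A)) subrr oppr0.
Qed.

Lemma curvature_bismut i j X Y : curvature br (bismut br J g e) i j X Y =
  K i j * wedge11 (g Z) (g (J Z)) X Y - G1 i j * b1 X Y - G2 i j * b2 X Y.
Proof.
have sE k l W : cform (bismut br J g e) k l W = G1 k l * g Z W + G2 k l * g (J Z) W.
  by rewrite /cform bismutE// g_bracket.
rewrite /curvature /d1 sE /K mulr_suml.
under eq_bigr => k _ do rewrite /wedge11 !sE.
rewrite addrC opprD addrA -!/(b1 _ _) -!/(b2 _ _) /b1 /b2 /bracket_form.
congr (_ - _ - _); apply: eq_bigr => k _; rewrite /wedge11; ring.
Qed.

(** The factor 1/2 could be any nonzero constant of square less than 1: it makes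
    [p1] smaller than the contribution of [b1] to [p1] of the Bismut
    connection. *)
Definition instanton (X : V) : 'M[R]_6 := bismut br J g e ((g Z X / 2) *: Z).

Lemma instantonE i j X : instanton X i j = 2^-1 * G1 i j * g Z X.
Proof. by rewrite /instanton bismutE// linearZ/= [g (br _ _) _]gC -/(G1 i j); ring. Qed.

Lemma instanton_linear : linear instanton.
Proof.
move=> a X Y; apply/matrixP => i j.
by rewrite [RHS]mxE [X in _ = X + _]mxE !instantonE linearP/=; ring.
Qed.

(** The quadratic term vanishes because all values are multiples of one matrix. *)
Lemma curvature_instanton i j X Y :
  curvature br instanton i j X Y = - (2^-1 * G1 i j) * b1 X Y.
Proof.
have sE k l W : cform instanton k l W = 2^-1 * G1 k l * g Z W := instantonE k l W.
rewrite /curvature /d1 sE big1 => [|k _]; last by rewrite /wedge11 !sE; ring.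
by rewrite addr0 mulNr.
Qed.

(** The curvature takes values in antisymmetric matrices, so the sum over
    [i < j] is half of the full double sum, which is a pairing. *)
Lemma p1_sum (s : V -> 'M[R]_6) X Y U W :
  (forall i j A B, curvature br s i j A B = - curvature br s j i A B) ->
  p1 br s X Y U W = (8 * pi ^+ 2)^-1 * (2^-1 *
    \sum_i \sum_j wedge22 (curvature br s i j) (curvature br s i j) X Y U W).
Proof.
move=> sC; congr (_ * _).
pose f i j := wedge22 (curvature br s i j) (curvature br s i j) X Y U W.
have fC i j : f i j = f j i by rewrite /f /wedge22 !(sC i j); ring.
have f0 i : f i i = 0.
  have s0 A B : curvature br s i i A B = 0 by have := sC i i A B => h; lra.
  by rewrite /f /wedge22 !s0; ring.
have fE i j : f i j = (if (i < j)%N then f i j else 0) + (if (j < i)%N then f j i else 0).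
  case: ltngtP => [_|_|/val_inj ->]; first by rewrite addr0.
    by rewrite add0r fC.
  by rewrite f0 addr0.
have -> : \sum_i \sum_j wedge22 (curvature br s i j) (curvature br s i j) X Y U W =
   (\sum_(i < 6) \sum_(j < 6) if (i < j)%N then f i j else 0) *+ 2.
  rewrite mulr2n [X in _ = _ + X]exchange_big -big_split; apply: eq_bigr => i _ /=.
  by rewrite -big_split; apply: eq_bigr => j _; exact: fE.
have half (x : R) : 2^-1 * (x *+ 2) = x by field.
rewrite half.
by apply: eq_bigr => i _; rewrite big_mkcond.
Qed.

Let N11 := pairing e b1 b1.
Let N12 := pairing e b1 b2.
Let N22 := pairing e b2 b2.

(** Terms linear in [eta = Z /\ JZ] have coefficients killed by
    [commutator_orthogonal], and [eta /\ eta = 0]. *)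
Lemma p1_bismut X Y U W : p1 br (bismut br J g e) X Y U W =
  (8 * pi ^+ 2)^-1 * (2^-1 * (N11 * wedge22 b1 b1 X Y U W
    + 2 * N12 * wedge22 b1 b2 X Y U W + N22 * wedge22 b2 b2 X Y U W)).
Proof.
rewrite p1_sum => [|i j A B]; last first.
  by rewrite !curvature_bismut commutatorC (G1C i) (G2C i); ring.
congr (_ * (_ * _)).
pose eta := wedge11 (g Z) (g (J Z)).
have [GK1 GK2] := commutator_orthogonal.
have expand i j : wedge22 (curvature br (bismut br J g e) i j)
    (curvature br (bismut br J g e) i j) X Y U W =
  G1 i j * G1 i j * wedge22 b1 b1 X Y U W
  + G1 i j * G2 i j * (2 * wedge22 b1 b2 X Y U W)
  + G2 i j * G2 i j * wedge22 b2 b2 X Y U W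
  - G1 i j * K i j * (2 * wedge22 b1 eta X Y U W)
  - G2 i j * K i j * (2 * wedge22 b2 eta X Y U W).
  by rewrite /wedge22 !curvature_bismut /eta /wedge11; ring.
under eq_bigr => i _ do under eq_bigr => j _ do rewrite expand.
have sumM (F : 'I_6 -> 'I_6 -> R) c : \sum_i \sum_j F i j * c = (\sum_i \sum_j F i j) * c.
  by rewrite mulr_suml; apply: eq_bigr => i _; rewrite mulr_suml.
under eq_bigr => i _ do rewrite !big_split/= !sumrN.
rewrite !big_split/= !sumrN !sumM GK1 GK2 -/N11 -/N12 -/N22 /pairing.
by rewrite !mul0r !subr0 mulrA [N12 * 2]mulrC.
Qed.

Lemma p1_instanton X Y U W : p1 br instanton X Y U W =
  (8 * pi ^+ 2)^-1 * (8^-1 * (N11 * wedge22 b1 b1 X Y U W)).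
Proof.
rewrite p1_sum => [|i j A B]; last by rewrite !curvature_instanton (G1C i); ring.
congr (_ * _); rewrite /N11 /pairing mulr_suml !mulr_sumr; apply: eq_bigr => i _.
rewrite mulr_suml !mulr_sumr; apply: eq_bigr => j _.
by rewrite /wedge22 !curvature_instanton -/(G1 i j); field.
Qed.

Lemma su3_instanton_instanton : su3_instanton br J g e instanton.
Proof.
split=> [|i j|i j k l]; first exact: preserves_bismut.
  by rewrite !curvature_instanton -!mulrDr bracket_form_primitive mulr0.
have [_ _ bJ] := bracket_form_props Z.
by rewrite !curvature_instanton /b1 bJ.
Qed.

Lemma instanton_non_flat X Y : b1 X Y != 0 -> non_flat br instanton.
Proof.
move=> bXY; have ue : e \in unitmx by case: adapted.
have [b1l b1C _] := bracket_form_props Z.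
have N11_gt0 : 0 < N11 := pairing_gt0 ue b1l b1C bXY.
have [i [j Gij]] : exists i j, G1 i j != 0.
  apply: contrapT => /forallNP h; move: N11_gt0; rewrite /N11 /pairing.
  rewrite big1 ?ltxx// => i _; rewrite big1// => j _.
  have /forallNP/(_ j)/negP := h i.
  by rewrite negbK => /eqP; rewrite /G1 => ->; rewrite mul0r.
exists i, j, (row i e), (row j e).
by rewrite curvature_instanton mulf_neq0// oppr_eq0 mulf_neq0// invr_eq0 pnatr_eq0.
Qed.

Lemma anomaly X0 Y0 : b1 X0 Y0 != 0 ->
  exists2 alpha' : R, 0 < alpha' & forall X Y U W, d3 br (torsionT br J g) X Y U W =
    2 * pi ^+ 2 * alpha' * (p1 br (bismut br J g e) X Y U W - p1 br instanton X Y U W).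
Proof.
move=> b0; have ue : e \in unitmx by case: adapted.
have [b1l b1C _] := bracket_form_props Z.
have N11_gt0 : 0 < N11 := pairing_gt0 ue b1l b1C b0.
have N22_ge0 : 0 <= N22 := pairing_ge0 e b2.
have [E aE E5] := exists_adapted_frame J_linear JJ g_inner gJJ ZZ.
have asd1 : asd J E b1 by exact: asd_bracket_form.
have asd2 : asd J E b2 by exact: asd_bracket_form.
have wedgeE := wedge_asd JJ g_inner adapted aE.
have D0 : 0 < 3 * N11 ^+ 2 + 8 * N12 ^+ 2 + 4 * N22 ^+ 2.
  have := exprn_gt0 2 N11_gt0; have := sqr_ge0 N12; have := sqr_ge0 N22; lra.
exists (32 * (N11 + N22) / (3 * N11 ^+ 2 + 8 * N12 ^+ 2 + 4 * N22 ^+ 2)).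
  by apply: divr_gt0 => //; lra.
(* by [wedge_asd] both sides are multiples of one 4-form; the constant solves
   the resulting scalar equation *)
move=> X Y U W; rewrite d_torsion_wedge.
rewrite p1_bismut p1_instanton -/b1 -/b2 !wedgeE// -/N11 -/N12 -/N22.
have : pi != 0 :> R by rewrite gt_eqF// pi_gt0.
move: (pi : R) (lt0r_neq0 D0) => q D_neq0 q_neq0.
by field; rewrite q_neq0.
Qed.

End Bismut.

(** * The solution of the Strominger system *)

Theorem theorem5p5 (R : realType)
    (br : 'rV[R]_6 -> 'rV[R]_6 -> 'rV[R]_6) (Gamma : set 'rV[R]_6)
    (J : 'rV[R]_6 -> 'rV[R]_6) (g : 'rV[R]_6 -> 'rV[R]_6 -> R)
    (e : 'M[R]_6) :
  lie_bracket br -> is_h5 br -> lattice br Gamma ->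
  complex_structure br J -> abelian_structure br J ->
  inner_product g -> hermitian_metric J g -> balanced br J g ->
  adapted_frame J g e ->
  exists A : {linear 'rV[R]_6 -> 'M[R]_6},
    solves_strominger br J g e Gamma A.
Proof.
move=> br_lie h5 _ [J_linear JJ _] brJJ g_inner gJJ bal adapted.
have [Z Zc [X0 [Y0 b0]]] := h5_center br_lie J_linear JJ brJJ g_inner gJJ h5.
pose A : {linear 'rV[R]_6 -> 'M[R]_6} := HB.pack (instanton br J g Z e)
  (GRing.isLinear.Build R _ _ *:%R (instanton br J g Z e)
    (instanton_linear br_lie JJ brJJ g_inner Z e)).
exists A; split=> //.
- move=> x P [c _]; apply: transport_SU3 => //.
  exact: (preserves_bismut br_lie J_linear JJ brJJ g_inner gJJ Zc adapted bal id).
- split; first exact: su3_instanton_instanton.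
  exact: instanton_non_flat b0.
- exact: anomaly b0.
Qed.
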